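(* Let $n \geq t \geq 1$ be integers and let $\mathcal{F} = 2^{[n]}$. Then \[\beta(\mathcal{F},t) = \frac{l(\mathcal{F},t)}{|\mathcal{F}|} = \frac{|\mathcal{K}_{n,t}|}{2^n},\] where $\mathcal{K}_{n,t} = \{A \subseteq [n] : |A| \geq (n+t)/2\}$ if $n+t$ is even, and $\mathcal{K}_{n,t} = \{A \subseteq [n] : |A \cap [n-1]| \geq (n+t-1)/2\}$ if $n+t$ is odd.
   Context: $[n] = \{1,\dots,n\}$ and $2^{[n]}$ is the family of all subsets of $[n]$. A family $\mathcal{A}$ is $t$-intersecting if $|A \cap B| \geq t$ for all $A, B \in \mathcal{A}$ with $A \neq B$; $l(\mathcal{F},t)$ is the size of a largest $t$-intersecting sub-family of $\mathcal{F}$. For a family $\mathcal{A}$, $\mathcal{A}^{t,+} = \{A \in \mathcal{A} : |A \cap B| \geq t \text{ for all } B \in \mathcal{A}\setminus\{A\}\}$ and $\mathcal{A}^{t,-} = \mathcal{A} \setminus \mathcal{A}^{t,+}$. For $\mathcal{A} \subseteq \mathcal{F}$, $\beta(\mathcal{F},t,\mathcal{A}) = \frac{l(\mathcal{F},t) - |\mathcal{A}^{t,+}|}{|\mathcal{A}^{t,-}|}$ if $\mathcal{A}^{t,-} \neq \emptyset$, and $\frac{l(\mathcal{F},t)}{|\mathcal{F}|}$ otherwise; $\beta(\mathcal{F},t) = \min_{\mathcal{A} \subseteq \mathcal{F}} \beta(\mathcal{F},t,\mathcal{A})$. *)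

(* Defs.v *)
From HB Require Import structures.
From mathcomp Require Import all_boot all_order all_algebra.
Set Implicit Arguments. Unset Strict Implicit. Unset Printing Implicit Defensive.
Import Order.TTheory GRing.Theory Num.Theory.

Section Defs.
Variable T : finType.

Definition t_intersecting (G : {set {set T}}) (t : nat) : bool :=
  [forall X in G, forall Y in G, (X != Y) ==> (t <= #|X :&: Y|)].

Definition lsize (F : {set {set T}}) (t : nat) : nat :=
  \max_(G : {set {set T}} | (G \subset F) && t_intersecting G t) #|G|.

Definition plus_part (A : {set {set T}}) (t : nat) : {set {set T}} :=
  [set X in A | [forall Y in A, (Y != X) ==> (t <= #|X :&: Y|)]].
Definition minus_part (A : {set {set T}}) (t : nat) : {set {set T}} :=
  A :\: plus_part A t.

Definition beta_at (F : {set {set T}}) (t : nat) (A : {set {set T}}) : rat :=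
  if minus_part A t == set0 then ((lsize F t)%:R / #|F|%:R)%R
  else (((lsize F t)%:R - #|plus_part A t|%:R) / #|minus_part A t|%:R)%R.

(* beta(F,t) = min over A ⊆ F of beta(F,t,A).  The empty family A = set0
   is a subfamily of F with beta(F,t,set0) = l(F,t)/|F|, so we may use that
   value as the neutral element of the iterated minimum. *)
Definition beta (F : {set {set T}}) (t : nat) : rat :=
  \big[Num.min/((lsize F t)%:R / #|F|%:R)%R]_(A : {set {set T}} | A \subset F)
     beta_at F t A.
End Defs.

(* The ground set [n] is modelled by 'I_n (element i <-> i+1). *)
Definition Kfam (n t : nat) : {set {set 'I_n}} :=
  if ~~ odd (n + t) then [set A : {set 'I_n} | (n + t)./2 <= #|A|]
  else [set A : {set 'I_n} |
          (n + t - 1)./2 <= #|A :&: [set i : 'I_n | (i < n - 1)%N]|].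

(* Main.v *)
(* Write A+ and A- for the plus and minus parts of A, and K for Kfam n t.  Any
   t-intersecting family of subsets of [n] has Hamming diameter at most n - t, and
   by Kleitman's theorem a family of that diameter has at most |K| members, so
   l(F,t) = |K|.  Unlike t-intersection, the diameter is invariant under
   translations of the cube: for every Z the family A+ \cup ((K + Z) \cap A-) still
   has diameter at most n - t, whence |A+| + |(K + Z) \cap A-| <= |K|.  Summing over
   all Z gives 2^n |A+| + |K| |A-| <= 2^n |K|, that is, beta(F,t,A) >= |K| / 2^n.

   Kleitman's theorem is reduced by up-compressions and shifts to shifted
   t-intersecting families; splitting such a family according to the least element
   yields the recursion k(n+1,t) <= k(n,t-1) + k(n,t+1), which |K| satisfies with
   equality. *)
Require Import Defs.
From mathcomp Require Import all_boot all_order all_algebra.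
From mathcomp Require Import zify.
Import Order.TTheory GRing.Theory Num.Theory.

Set Implicit Arguments.
Unset Strict Implicit.
Unset Printing Implicit Defensive.

(** * Symmetric difference as translation of the cube *)

Section SymmetricDifference.
Variable T : finType.
Implicit Types X Y Z : {set T}.

Definition symd X Y : {set T} := [set x | (x \in X) (+) (x \in Y)].

Lemma symdC X Y : symd X Y = symd Y X.
Proof. by apply/setP => x; rewrite !inE addbC. Qed.

Lemma symdA X Y Z : symd X (symd Y Z) = symd (symd X Y) Z.
Proof. by apply/setP => x; rewrite !inE addbA. Qed.

Lemma symdv X : symd X X = set0.
Proof. by apply/setP => x; rewrite !inE addbb. Qed.

Lemma symd0 X : symd X set0 = X.
Proof. by apply/setP => x; rewrite !inE addbF. Qed.

Lemma symdK Z : involutive (fun X => symd X Z).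
Proof. by move=> X; rewrite -symdA symdv symd0. Qed.

Lemma symd_translate X Y Z : symd (symd X Z) (symd Y Z) = symd X Y.
Proof. by rewrite (symdC Y) symdA -(symdA X) symdv symd0. Qed.

Lemma card_symd X Y : #|symd X Y| + #|X :&: Y| = #|X :|: Y|.
Proof.
have -> : X :|: Y = symd X Y :|: X :&: Y.
  by apply/setP => x; rewrite !inE; do 2!case: (_ \in _).
rewrite cardsU (_ : _ :&: (X :&: Y) = set0) ?cards0 ?subn0 //.
by apply/setP => x; rewrite !inE; do 2!case: (_ \in _).
Qed.

(** At least half of [[set i; j]] lies in [Z], so the translation deletes at least as many points as
    it adds. *)
Lemma card_symd2 Z (i j : T) :
  (i \in Z) || (j \in Z) -> #|symd Z [set i; j]| <= #|Z|.
Proof.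
move=> ijZ; set e := [set i; j].
have De : #|e| <= 2 * #|Z :&: e|.
  have Ze0 : 0 < #|Z :&: e|.
    apply/card_gt0P; case/orP: ijZ => h; [exists i | exists j];
      by rewrite !inE eqxx h ?orbT.
  by have := cards2 i j; rewrite -/e => ->; case: eqP; lia.
have := card_symd Z e; have := cardsUI Z e; lia.
Qed.

End SymmetricDifference.

(** * Compressions and shifts of families of bounded diameter *)

Section Compression.
Variable n : nat.
Implicit Types (X Y : {set 'I_n}) (F : {set {set 'I_n}}) (i j : 'I_n).

Definition diam_le F d : Prop :=
  forall X Y, X \in F -> Y \in F -> #|symd X Y| <= d.

(* For [i < j] this is the shift replacing [j] by [i]; for [i = j] it is the
   up-compression adding [i].  Both act as translation by [[set i; j]]. *)
Definition movable i j X := (i \notin X) && ((j == i) || (j \in X)).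
Definition move i j X := symd X [set i; j].

(** Potential raised by every move with [i <= j]: each summand is positive, and smaller elements
    count more. *)
Definition weight X := \sum_(x in X) (n - x).

Lemma setD1_notin i X : i \notin X -> X :\ i = X.
Proof.
move=> iX; apply/setP => x; rewrite !inE; case: eqP => // ->.
by rewrite (negPf iX).
Qed.

Lemma weight_move i j X :
  i <= j -> movable i j X -> weight X < weight (move i j X).
Proof.
move=> le_ij /andP[iX jX].
have iXj : i \notin X :\ j by rewrite !inE negb_and iX orbT.
have -> : move i j X = i |: (X :\ j).
  apply/setP => x; rewrite !inE.
  case: (eqVneq x i) => [->|xi]; first by rewrite (negPf iX).
  case: (eqVneq x j) => [xj|xj] /=; last by case: (x \in X).
  by rewrite xj; case/orP: jX => [/eqP ji|->//]; rewrite xj ji eqxx in xi.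
rewrite /weight big_setU1 //=.
case/orP: jX => [/eqP->|jX].
  by rewrite (setD1_notin iX) -[X in X < _]add0n ltn_add2r subn_gt0.
rewrite (big_setD1 j jX) /=.
have neq : (i : nat) != j by apply: contraNneq iX => /val_inj->.
rewrite ltn_add2r ltn_sub2l // ltn_neqAle neq //.
Qed.

Definition moved i j F := [set X in F | movable i j X && (move i j X \notin F)].

Definition compress i j F :=
  (F :\: moved i j F) :|: [set move i j X | X in moved i j F].

Lemma moved_sub i j F : moved i j F \subset F.
Proof. by apply/subsetP => X; rewrite inE => /andP[]. Qed.

Lemma move_inj i j : injective (move i j).
Proof. exact: (inv_inj (symdK [set i; j])). Qed.

Lemma compress_disjoint i j F :
  [disjoint F :\: moved i j F & [set move i j X | X in moved i j F]].
Proof.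
rewrite disjoint_sym disjoint_subset; apply/subsetP => _ /imsetP[X + ->].
by rewrite !inE => /and3P[_ _ /negPf->]; rewrite andbF.
Qed.

Lemma card_compress i j F : #|compress i j F| = #|F|.
Proof.
rewrite cardsU (eqP (_ : _ :&: _ == set0)); last first.
  by rewrite setI_eq0 compress_disjoint.
rewrite cards0 subn0 card_imset; last exact: move_inj.
by rewrite cardsD (setIidPr (moved_sub i j F)) subnK ?subset_leq_card ?moved_sub.
Qed.

Lemma weight_compress i j F : i <= j -> moved i j F != set0 ->
  \sum_(X in F) weight X < \sum_(X in compress i j F) weight X.
Proof.
move=> le_ij /set0Pn[X0 X0M].
rewrite (big_setID (moved i j F)) /= (setIidPr (moved_sub i j F)) addnC.
have -> : \sum_(X in compress i j F) weight X =
    \sum_(X in F :\: moved i j F) weight X +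
    \sum_(X in [set move i j X | X in moved i j F]) weight X.
  rewrite -bigU ?compress_disjoint //; apply: eq_bigl => X; exact: in_setU.
rewrite ltn_add2l.
rewrite big_imset /=; last by move=> X Y _ _; apply: move_inj.
have lt_w X : X \in moved i j F -> weight X < weight (move i j X).
  by rewrite inE => /and3P[_ mX _]; apply: weight_move.
rewrite (big_setD1 X0 X0M) [X in _ < X](big_setD1 X0 X0M) /= -addSn.
rewrite leq_add ?lt_w // leq_sum // => X; rewrite inE => /andP[_ XM].
exact/ltnW/lt_w.
Qed.

(** Only a moved [X] against an unmoved [Y] can change distance. If [Y] stays because its image is
    already in [F], the distance is that from [X] to this image. Otherwise [symd X Y] contains [i]
    or [j], and the translation cannot enlarge it. *)
Lemma diam_compress i j F d : diam_le F d -> diam_le (compress i j F) d.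
Proof.
move=> dF.
have mix X Y : X \in moved i j F -> Y \in F :\: moved i j F ->
    #|symd (move i j X) Y| <= d.
  rewrite !inE => /and3P[XF mX _] /andP[+ YF]; rewrite YF /= negb_and negbK.
  case mY: (movable i j Y) => /=; [move=> mYF | move=> _].
    by rewrite -symdA (symdC _ Y); apply: dF.
  apply: leq_trans (dF _ _ XF YF).
  rewrite /move -symdA (symdC [set i; j]) symdA; apply: card_symd2.
  move: mX mY; rewrite /movable !inE.
  case: (eqVneq j i) => [->|_] /=; first by do 2!case: (i \in _).
  by case: (i \in X); case: (j \in X); case: (i \in Y); case: (j \in Y).
move=> X Y; rewrite !(in_setU _ (F :\: _)).
case/orP=> [XF|/imsetP[X' X'M ->]]; case/orP=> [YF|/imsetP[Y' Y'M ->]].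
- by apply: dF; [case/setDP: XF | case/setDP: YF].
- by rewrite symdC; apply: mix.
- exact: mix.
- by rewrite symd_translate; apply: dF; apply: (subsetP (moved_sub i j F)).
Qed.

(** Take a family of maximal total weight among those of this size and diameter: any remaining move
    would raise it. *)
Lemma exists_compressed F d : diam_le F d ->
  exists G : {set {set 'I_n}}, [/\ #|G| = #|F|, diam_le G d &
    forall i j X, i <= j -> X \in G -> movable i j X -> move i j X \in G].
Proof.
move=> dF.
pose diamb (G : {set {set 'I_n}}) :=
  [forall X in G, forall Y in G, #|symd X Y| <= d].
have diamP G : reflect (diam_le G d) (diamb G).
  apply: (iffP forall_inP) => [h X Y XG YG | h X XG].
    exact: (forall_inP (h X XG)).
  by apply/forall_inP => Y YG; apply: h.
pose P (G : {set {set 'I_n}}) := (#|G| == #|F|) && diamb G.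
have PF : P F by rewrite /P eqxx; apply/diamP.
case: (arg_maxnP (fun G : {set {set 'I_n}} => \sum_(X in G) weight X) PF).
move=> G /andP[/eqP cG /diamP dG] maxG; exists G; split=> // i j X le_ij XG mX.
apply: contraT => mXG.
have M0 : moved i j G != set0 by apply/set0Pn; exists X; rewrite inE XG mX.
have /maxG : P (compress i j G).
  by rewrite /P card_compress cG eqxx; apply/diamP/diam_compress.
by rewrite /= leqNgt weight_compress.
Qed.

(** The moves with [i = j] add the missing points one at a time. *)
Lemma compressed_upset F :
  (forall i j X, i <= j -> X \in F -> movable i j X -> move i j X \in F) ->
  forall X Y, X \in F -> X \subset Y -> Y \in F.
Proof.
move=> mF X Y XF; have [m] := ubnP #|Y :\: X|.
elim: m X XF => // m IH X XF lt_m sXY.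
have [YX0|[x xYX]] := set_0Vmem (Y :\: X).
  suff -> : Y = X by [].
  by apply/eqP; rewrite eqEsubset sXY andbT -setD_eq0 YX0.
have [xY xX] := setDP xYX.
have mE : move x x X = x |: X.
  by apply/setP => y; rewrite !inE; case: eqP => [->|_]; rewrite ?(negPf xX) ?addbF.
apply: (IH (x |: X)).
- by rewrite -mE mF // /movable xX eqxx.
- by move: lt_m; rewrite (cardsD1 x (Y :\: X)) xYX setUC -setDDl.
- by rewrite subUset sub1set xY.
Qed.

End Compression.

(** * Intersecting families and Kleitman's diameter theorem *)

Lemma card_split (T : finType) (i : T) (F : {set {set T}}) :
  #|F| = #|[set X in F | i \notin X]| + #|[set X :\ i | X in F & i \in X]|.
Proof.
rewrite card_in_imset => [|X Y].
  rewrite -(cardsID [set X : {set T} | i \in X] F) addnC; congr (_ + _).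
    by apply: eq_card => X; rewrite !inE andbC.
  by apply: eq_card => X; rewrite !inE.
by rewrite !inE => /andP[_ iX] /andP[_ iY] e; rewrite -(setD1K iX) e setD1K.
Qed.

(* Equal to [#|Kfam n t|] for [1 <= t <= n]; the values at [t = 0] are junk. *)
Fixpoint katona n t : nat :=
  match n, t with
  | 0, _ => 0
  | n'.+1, t'.+2 => katona n' t'.+1 + katona n' t'.+3
  | n'.+1, _ => 2 ^ n'
  end.

(** No member of [F] has its complement in [S] also in [F], so [F] is at most half of the power
    set. *)
Lemma card_intersecting (T : finType) (S : {set T}) m (F : {set {set T}}) :
  #|S| = m.+1 -> F \subset powerset S ->
  (forall X Y, X \in F -> Y \in F -> 0 < #|X :&: Y|) -> #|F| <= 2 ^ m.
Proof.
move=> cS FS tF; pose C := [set S :\: X | X in F].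
have sub X : X \in F -> X \subset S by move=> /(subsetP FS); rewrite powersetE.
have cC : #|C| = #|F|.
  apply: card_in_imset => X Y XF YF eXY.
  rewrite -(setIidPr (sub X XF)) -(setIidPr (sub Y YF)).
  by rewrite -[LHS]set0U -[RHS]set0U -(setDv S) -!setDDr eXY.
have FC0 : F :&: C = set0.
  apply/setP => X; rewrite !inE; apply/negP => /andP[XF /imsetP[Y YF eX]].
  by have := tF X Y XF YF; rewrite eX setIDAC -setIDA setDv setI0 cards0.
have: #|F :|: C| <= #|powerset S|.
  rewrite subset_leq_card // subUset FS; apply/subsetP => _ /imsetP[Y YF ->].
  by rewrite powersetE subsetDl.
by rewrite cardsU FC0 cards0 cC card_powerset cS expnS; lia.
Qed.

(* In a shifted family the members avoiding the least element [i] of the ground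
   set are (t+1)-intersecting: if [X] and [Y] met in exactly [t] points, then
   replacing one of these points by [i] in [X] would leave only [t - 1]. *)
Lemma card_shifted_intersecting n (S : {set 'I_n}) t (F : {set {set 'I_n}}) :
  0 < t -> F \subset powerset S ->
  (forall (i j : 'I_n) X, i \in S -> i < j -> X \in F -> j \in X -> i \notin X ->
     i |: (X :\ j) \in F) ->
  (forall X Y, X \in F -> Y \in F -> t <= #|X :&: Y|) ->
  #|F| <= katona #|S| t.
Proof.
have [m cS] : exists m, #|S| = m by eexists.
rewrite cS; elim: m S cS t F => [|m IH] S cS t F t0 FS shF tF.
  have [->|[X XF]] := set_0Vmem F; first by rewrite cards0.
  have XS : X \subset S by rewrite -powersetE (subsetP FS).
  have := tF X X XF XF; rewrite setIid.
  have := subset_leq_card XS; lia.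
(* For [t = 1] there is no recursion: the bound is half of the power set. *)
case: t t0 tF => [//|[_|t _]] tF /=; first exact: card_intersecting cS FS tF.
have sub X : X \in F -> X \subset S by move=> /(subsetP FS); rewrite powersetE.
have [i0 i0S] : exists i, i \in S by apply/card_gt0P; rewrite cS.
case: (arg_minnP (fun i : 'I_n => i : nat) i0S) => i iS' mini.
have {iS'} iS : i \in S := iS'.
have cSi : #|S :\ i| = m by move: cS; rewrite (cardsD1 i) iS => -[].
have lti (j : 'I_n) X : X \in F -> j \in X -> i != j -> i < j.
  move=> XF jX ij; rewrite ltn_neqAle; apply/andP; split=> //.
  by apply/mini/(subsetP (sub X XF)).
(* Deleting [i] from the members containing it costs one common point, which gives [katona m t.+1];
   the members avoiding [i] give the other summand. *)
rewrite (card_split i) addnC leq_add //; apply: (IH _ cSi) => //.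
- apply/subsetP => _ /imsetP[X + ->]; rewrite inE => /andP[XF iX].
  by rewrite powersetE setSD // sub.
- move=> a b _ aS ab /imsetP[X + ->]; rewrite inE => /andP[XF iX].
  move: aS; rewrite !inE => /andP[ai aS] /andP[bi bX]; rewrite ai /= => aX.
  apply/imsetP; exists (a |: (X :\ b)).
    by rewrite !inE iX (eq_sym i b) bi orbT shF.
  apply/setP => x; rewrite !inE; case: (eqVneq x a) => [->|_] //=.
    by rewrite ai.
  by rewrite andbCA.
- move=> _ _ /imsetP[X + ->] /imsetP[Y + ->].
  rewrite !inE => /andP[XF iX] /andP[YF iY].
  by have := tF X Y XF YF; rewrite -setDIl (cardsD1 i) inE iX iY.
- apply/subsetP => X; rewrite inE => /andP[XF iX].
  by rewrite powersetE subsetD1 sub.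
- move=> a b X; rewrite !inE => /andP[ai aS] ab /andP[XF iX] bX aX.
  by rewrite shF //= !negb_or (eq_sym i a) ai negb_and iX orbT.
- move=> X Y; rewrite !inE => /andP[XF iX] /andP[YF iY].
  rewrite ltn_neqAle tF // andbT; apply/negP => /eqP tXY.
  have [x xXY] : exists x, x \in X :&: Y by apply/card_gt0P; rewrite -tXY.
  have /setIP[xX xY] := xXY.
  have ix : i != x by apply: contraNneq iX => ->.
  have := tF _ _ (shF i x X iS (lti x X XF xX ix) XF xX iX) YF.
  rewrite (_ : _ :&: Y = (X :&: Y) :\ x); last first.
    apply/setP => y; rewrite !inE; case: (eqVneq y i) => [->|_] /=.
      by rewrite (negPf iY) !andbF.
    by rewrite andbA.
  by rewrite tXY (cardsD1 x (X :&: Y)) xXY add1n ltnn.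
Qed.

(* Kleitman's diameter theorem.  In an up-set, enlarging [X] by the complement of
   [X :|: Y] turns a bound on distances into a lower bound on [#|X :&: Y|]. *)
Lemma card_diam_le n t (F : {set {set 'I_n}}) :
  0 < t <= n -> diam_le F (n - t) -> #|F| <= katona n t.
Proof.
move=> /andP[t0 tn] /exists_compressed[G [<- dG mG]].
have uG := compressed_upset mG.
rewrite -[X in katona X]card_ord -cardsT.
apply: card_shifted_intersecting => //.
- by apply/subsetP => X _; rewrite powersetE subsetT.
- move=> i j X _ ij XG jX iX.
  have -> : i |: (X :\ j) = move i j X.
    apply/setP => x; rewrite !inE.
    case: (eqVneq x i) => [->|_] /=; first by rewrite (negPf iX).
    by case: (eqVneq x j) => [->|_]; rewrite ?jX ?addbF.
  by apply: mG => //; [exact: ltnW | rewrite /movable iX jX orbT].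
move=> X Y XG YG; pose X' := X :|: ~: (X :|: Y).
have X'G : X' \in G by apply: uG XG _; rewrite subsetUl.
have := card_symd X' Y; have := dG _ _ X'G YG.
have -> : X' :|: Y = setT.
  by apply/setP => x; rewrite !inE; do 2!case: (_ \in _).
have -> : X' :&: Y = X :&: Y.
  by apply/setP => x; rewrite !inE; do 2!case: (_ \in _).
by rewrite cardsT card_ord; lia.
Qed.

(** * Binomial tails and the size of [Kfam] *)

Fixpoint tail n j : nat :=
  match j, n with
  | 0, _ => 2 ^ n
  | _.+1, 0 => 0
  | j'.+1, n'.+1 => tail n' j' + tail n' j
  end.

Lemma card_tail (T : finType) (S : {set T}) j :
  #|[set X in powerset S | j <= #|X|]| = tail #|S| j.
Proof.
have ge0 (U : {set T}) : #|[set X in powerset U | 0 <= #|X|]| = 2 ^ #|U|.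
  by rewrite -card_powerset; apply: eq_card => X; rewrite in_set andbT.
have [m cS] : exists m, #|S| = m by eexists.
rewrite cS; elim: m S cS j => [|m IH] S cS [|j] /=.
- by rewrite ge0 cS.
- apply: eq_card0 => X; rewrite !inE.
  by apply/negP => /andP[/subset_leq_card]; lia.
- by rewrite ge0 cS.
have [i iS] : exists i, i \in S by apply/card_gt0P; rewrite cS.
have cSi : #|S :\ i| = m by move: cS; rewrite (cardsD1 i) iS => -[].
rewrite (card_split i) addnC -!(IH _ cSi); congr (_ + _); apply: eq_card => X.
  rewrite !inE subsetD1; apply/imsetP/idP => [[Y]|/andP[/andP[XS iX] jX]].
    rewrite !inE => /andP[/andP[YS jY] iY] ->.
    rewrite !inE eqxx andbT (subset_trans (subsetDl _ _) YS).
    by move: jY; rewrite (cardsD1 i) iY.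
  exists (i |: X); last by rewrite setU1K.
  by rewrite !inE subUset sub1set iS XS eqxx cardsU1 iX add1n ltnS jX.
by rewrite !inE subsetD1 andbAC.
Qed.

Lemma tail_gt n j : n < j -> tail n j = 0.
Proof. by elim: n j => [|n IH] [|j] //= lt_nj; rewrite !IH //; lia. Qed.

(** Complementation exchanges the sizes below [j] with the sizes at least [s]; the induction uses
    Pascal's rule. *)
Lemma tailD n j s : j + s = n.+1 -> tail n j + tail n s = 2 ^ n.
Proof.
elim: n j s => [|n IH] [|j] [|s] //= e; try by case: j e => [|[]].
- by rewrite !tail_gt //; lia.
- by rewrite !tail_gt //; lia.
have := IH j s.+1; have := IH j.+1 s; rewrite expnS; lia.
Qed.

(** With [r] half of [n + t], the recursion of [katona] becomes Pascal's rule for tails. *)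
Lemma katona_even n t r : 0 < t -> n + t = r.*2 -> katona n t = tail n r.
Proof.
elim: n t r => [|n IH] t r t0 e; first by rewrite tail_gt //; lia.
case: t t0 e => [//|[_|t _]] e.
  (* Here [n.+1 = 2r - 1] is odd, so the sets of size at least [r] are exactly half of the cube. *)
  by have := @tailD n.+1 r r; rewrite expnS /=; lia.
case: r e => [|r] e; first by lia.
by rewrite /= (IH t.+1 r) ?(IH t.+3 r.+1) //; lia.
Qed.

(** One of the [n.+1] points is free, whence the doubling. *)
Lemma katona_odd n t r : 0 < t -> n + t = r.*2 -> katona n.+1 t = (tail n r).*2.
Proof.
elim: n t r => [|n IH] t r t0 e.
  by rewrite tail_gt; [case: t t0 e => [|[|]] //; lia | lia].
case: t t0 e => [//|[_|t _]] e.
  by have := @tailD n.+1 r r; rewrite /=; lia.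
case: r e => [|r] e; first by lia.
rewrite (_ : katona n.+2 t.+2 = katona n.+1 t.+1 + katona n.+1 t.+3) //.
by rewrite (IH t.+1 r) ?(IH t.+3 r.+1) /=; lia.
Qed.

Lemma card_ord_le n (X : {set 'I_n}) : #|X| <= n.
Proof. by have := max_card X; rewrite card_ord. Qed.

Lemma low_ordE n : [set i : 'I_n.+1 | i < n] = setT :\ ord_max.
Proof.
apply/setP => i; rewrite !inE andbT -val_eqE /=.
by have := ltn_ord i; lia.
Qed.

Lemma card_low_ord n : #|[set i : 'I_n.+1 | i < n]| = n.
Proof.
rewrite low_ordE.
by have := cardsD1 ord_max [set: 'I_n.+1]; rewrite cardsT card_ord inE => -[].
Qed.

Lemma card_Kfam n t : 0 < t <= n -> #|Kfam n t| = katona n t.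
Proof.
move=> /andP[t0 tn]; rewrite /Kfam; case: ifPn => odd_nt.
  rewrite (@katona_even _ _ (n + t)./2) //; last by rewrite even_halfK.
  rewrite -[X in tail X _]card_ord -cardsT -card_tail.
  by apply: eq_card => X; rewrite !inE subsetT.
case: n tn odd_nt => [|n] tn; first by lia.
rewrite negbK => odd_nt; rewrite (_ : n.+1 + t - 1 = n + t) //; last lia.
rewrite (@katona_odd _ _ (n + t)./2) //; last by rewrite even_halfK.
rewrite (_ : n.+1 - 1 = n) //; last lia.
set S := [set i : 'I_n.+1 | i < n]; set r := (n + t)./2.
have -> : tail n r = #|[set X in powerset S | r <= #|X|]|.
  by rewrite card_tail card_low_ord.
(* Membership ignores [ord_max], so both halves of the split are copies of the tail on [S]. *)
rewrite -addnn (card_split ord_max).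
have sub (X : {set 'I_n.+1}) : (X \subset S) = (ord_max \notin X).
  by rewrite /S low_ordE subsetD1 subsetT.
congr (_ + _); apply: eq_card => X; rewrite !inE.
  by rewrite sub andbC; case: (boolP (_ \in X)) => //= h; rewrite (setIidPl _) ?sub.
apply/imsetP/idP => [[Y]|/andP[XS rX]].
  rewrite !inE => /andP[rY mY] ->; rewrite sub !inE eqxx /=.
  suff -> : Y :\ ord_max = Y :&: S by [].
  apply/setP => i; rewrite !inE andbC -val_eqE /=.
  by congr (_ && _); have := ltn_ord i; lia.
exists (ord_max |: X); last by rewrite setU1K // -sub.
rewrite !inE eqxx andbT setIUl (_ : [set ord_max] :&: S = set0) ?set0U.
  by rewrite (setIidPl XS).
by apply/setP => i; rewrite !inE -val_eqE /=; apply/negP; lia.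
Qed.

(** Inclusion-exclusion on all [n] points, or on the first [n - 1] when [n + t] is odd. *)
Lemma Kfam_intersecting n t X Y :
  0 < t <= n -> X \in Kfam n t -> Y \in Kfam n t -> t <= #|X :&: Y|.
Proof.
move=> /andP[t0 tn]; rewrite /Kfam; case: ifPn => odd_nt; rewrite !inE => hX hY.
  have := cardsUI X Y; have := card_ord_le (X :|: Y).
  have := even_halfK odd_nt; lia.
case: n X Y tn odd_nt hX hY => [|n] X Y tn odd_nt; first by case: t t0 tn odd_nt.
rewrite addSn !subn1 /=.
set S := [set i : 'I_n.+1 | i < n] => hX hY.
have := cardsUI (X :&: S) (Y :&: S).
have : #|(X :&: S) :|: (Y :&: S)| <= #|S|.
  by rewrite subset_leq_card // subUset !subsetIr.
rewrite card_low_ord setIACA setIid.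
have := subset_leq_card (subsetIl (X :&: Y) S).
have : ~~ odd (n + t) by move: odd_nt; rewrite negbK.
move/even_halfK; move: hX hY.
move: #|X :&: S| #|Y :&: S| #|X :&: Y :&: S| #|X :&: Y| #|_ :|: _| => a b c e f.
lia.
Qed.

(** * From intersections to diameter: the value of [lsize] and the averaging argument *)

Lemma diam_le_of_intersecting n t X Y : t <= n ->
  (X != Y -> t <= #|X :&: Y|) -> #|@symd 'I_n X Y| <= n - t.
Proof.
(* The diagonal, exempt from the intersection condition, has distance 0. *)
move=> tn; have [->|_ /(_ isT)] := eqVneq X Y; first by rewrite symdv cards0.
have := card_symd X Y; have := card_ord_le (X :|: Y); lia.
Qed.

Lemma lsize_setT n t : 0 < t <= n -> lsize [set: {set 'I_n}] t = katona n t.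
Proof.
move=> tn; have /andP[t0 le_tn] := tn; apply/eqP; rewrite eqn_leq; apply/andP; split.
  apply/bigmax_leqP => G /andP[_ /forall_inP iG].
  apply: card_diam_le => // X Y XG YG.
  by apply: diam_le_of_intersecting => // XY; apply: implyP XY;
    apply: (forall_inP (iG X XG)).
rewrite -card_Kfam //; apply: leq_bigmax_cond; rewrite subsetT.
apply/forall_inP => X XK; apply/forall_inP => Y YK; apply/implyP => _.
exact: Kfam_intersecting.
Qed.

(** Double counting: each [Y] in [B] lies in exactly [#|K|] translates, one for each member of
    [K]. *)
Lemma sum_translate_card (T : finType) (K B : {set {set T}}) :
  \sum_(Z : {set T}) #|[set symd X Z | X in K] :&: B| = #|K| * #|B|.
Proof.
transitivity (\sum_(Z : {set T}) \sum_(Y in B) (symd Y Z \in K)).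
  apply: eq_bigr => Z _; rewrite -sum1_card -big_mkcondr /=.
  apply: eq_bigl => Y; rewrite inE andbC; congr (_ && _).
  apply/imsetP/idP => [[X XK ->]|YK]; first by rewrite (symdK Z).
  by exists (symd Y Z); rewrite ?(symdK Z).
rewrite exchange_big mulnC -sum_nat_const; apply: eq_bigr => Y _ /=.
rewrite -big_mkcond /= -sum1_card (reindex (symd Y)) /=.
  by apply: eq_bigl => Z; rewrite symdA symdv symdC symd0.
by exists (symd Y) => Z _; rewrite symdA symdv symdC symd0.
Qed.

Lemma plus_minus_card n t (A : {set {set 'I_n}}) : 0 < t <= n ->
  2 ^ n * #|plus_part A t| + katona n t * #|minus_part A t| <= 2 ^ n * katona n t.
Proof.
move=> tn; have /andP[t0 le_tn] := tn.
set P := plus_part A t; set M := minus_part A t.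
have cI : #|{set 'I_n}| = 2 ^ n.
  by rewrite -cardsT -powersetT card_powerset cardsT card_ord.
rewrite -card_Kfam // -sum_translate_card -cI -!sum_nat_const -big_split /=.
apply: leq_sum => Z _; set K := [set _ | _ in _].
have PM0 : P :&: (K :&: M) = set0.
  apply/setP => X; rewrite !in_setI in_setD in_set0 -/P.
  by case: (X \in P); rewrite ?andbF.
have <- : #|P :|: (K :&: M)| = #|P| + #|K :&: M| by rewrite cardsU PM0 cards0 subn0.
(* The union may fail to be t-intersecting, so the bound must come from its diameter. *)
rewrite card_Kfam //; apply: card_diam_le => //.
have PA X Y : X \in P -> Y \in A -> #|symd X Y| <= n - t.
  rewrite inE => /andP[_ /forall_inP hX] YA.
  apply: diam_le_of_intersecting => // XY.
  by apply: (implyP (hX Y YA)); rewrite eq_sym.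
have subA X : X \in P :|: (K :&: M) -> X \in A.
  by rewrite !inE => /orP[/andP[]|/and3P[]].
move=> X Y XU YU.
(* Members of [P] are close to all of [A]; two members outside [P] lie in the same translate of
   [Kfam n t]. *)
case XP: (X \in P); first by rewrite PA ?subA.
case YP: (Y \in P); first by rewrite symdC PA ?subA.
move: XU YU; rewrite !in_setU XP YP !in_setI /=.
case/andP=> /imsetP[X' X'K ->] _ /andP[/imsetP[Y' Y'K ->] _].
rewrite symd_translate; apply: diam_le_of_intersecting => // _.
by apply: Kfam_intersecting.
Qed.

Lemma bigmin_id d (T : orderType d) (I : finType) (P : pred I) (f : I -> T) (x : T) :
  (forall i, P i -> (x <= f i)%O) -> \big[Order.min/x]_(i | P i) f i = x.
Proof. by move=> h; elim/big_rec: _ => // i y Pi ->; apply/min_idPr/h. Qed.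

Theorem theorem3p10 (n t : nat) (ht1 : (1 <= t)%N) (htn : (t <= n)%N) :
  let F := [set: {set 'I_n}] in
  beta F t = ((lsize F t)%:R / #|F|%:R)%R /\
  ((lsize F t)%:R / #|F|%:R)%R = (#|Kfam n t|%:R / (2 ^ n)%:R : rat)%R.
Proof.
move=> F; have tn : 0 < t <= n by rewrite ht1.
have cF : #|F| = 2 ^ n by rewrite /F -powersetT card_powerset cardsT card_ord.
split; last by rewrite card_Kfam // lsize_setT // cF.
(* An empty minus part gives the default value; otherwise two positive denominators are cleared. *)
apply: bigmin_id => A _; rewrite /beta_at; case: ifPn => // M0.
rewrite lsize_setT // cF ler_pdivrMr ?ltr0n ?expn_gt0 // mulrAC.
rewrite ler_pdivlMr ?ltr0n ?card_gt0 // mulrBl lerBrDr -!natrM -natrD ler_nat.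
by have := plus_minus_card A tn; rewrite !(mulnC (2 ^ n)) addnC.
Qed.
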